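(* Let $r\ge2$ be an integer, let $c_1,\ldots,c_{r-1}$ and $\Lambda_{2r-1}$ be independent variables, and set $$S_m=-\sum_{a=1}^{r-1}c_ac_{m-a}\quad(r\le m\le 2r-2),\qquad S_{2r-1}=\Lambda_{2r-1},\qquad S_m=0\quad(m>2r-1),$$ where $c_a=0$ for $a<1$ or $a>r-1$. Let $$\mathcal V_0=\sum_{k=1}^{r-1}kc_k\frac{\partial}{\partial c_k}+(2r-1)\Lambda_{2r-1}\frac{\partial}{\partial\Lambda_{2r-1}}.$$ Then for each $1\le n\le r-1$ there exists a unique rational vector field of the form $$\mathcal V_n=\sum_{k=1}^{r-n}h_{n,k}(c_1,\ldots,c_{r-1},\Lambda_{2r-1})\frac{\partial}{\partial c_k}$$ such that $$\mathcal V_n(S_m)=(m-n)S_{m+n}\qquad(r\le m\le 2r-1).$$ Moreover, $[\mathcal V_0,\mathcal V_n]=n\mathcal V_n$ for $1\le n\le r-1$, and for $1\le m,n\le r-1$, $$[\mathcal V_m,\mathcal V_n]=\begin{cases}(n-m)\mathcal V_{m+n},& m+n\le r-1,\\ 0,& m+n\ge r.\end{cases}$$ Equivalently, putting $\mathcal V_N=0$ for $N\ge r$, $[\mathcal V_m,\mathcal V_n]=(n-m)\mathcal V_{m+n}$.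
   Context: A rational vector field is a derivation whose coefficients are rational functions over $\mathbb C$ in the variables $c_1,\ldots,c_{r-1},\Lambda_{2r-1}$; $[\cdot,\cdot]$ is the commutator of derivations. *)

(* Defs.v *)
From HB Require Import structures.
From mathcomp Require Import all_boot all_order all_algebra.
From mathcomp Require Import generic_quotient.
From mathcomp Require Import reals complex mpoly.
From mathcomp Require Import ring zify.

Set Implicit Arguments.
Unset Strict Implicit.
Unset Printing Implicit Defensive.

Import GRing.Theory.
Local Open Scope ring_scope.
Local Open Scope quotient_scope.

Lemma quotient_ruleD (F : fieldType) (a b p q a' b' p' q' : F) :
  b != 0 -> q != 0 ->
  ((a' * q + a * q' + (p' * b + p * b')) * (b * q)
     - (a * q + p * b) * (b' * q + b * q')) / (b * q) ^+ 2
  = (a' * b - a * b') / b ^+ 2 + (p' * q - p * q') / q ^+ 2.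
Proof. by move=> b0 q0; field; rewrite b0 q0. Qed.

Lemma quotient_ruleM (F : fieldType) (a b p q a' b' p' q' : F) :
  b != 0 -> q != 0 ->
  ((a' * p + a * p') * (b * q) - a * p * (b' * q + b * q')) / (b * q) ^+ 2
  = (a' * b - a * b') / b ^+ 2 * (p / q)
    + a / b * ((p' * q - p * q') / q ^+ 2).
Proof. by move=> b0 q0; field; rewrite b0 q0. Qed.

Section FractionDerivation.
Variables (P : idomainType) (D : P -> P).
Local Notation K := {fraction P}.
Local Notation tofrac := (@FracField.tofrac P).
Implicit Types (p q : P) (f g : K).

Definition numer f : P := \n_(repr f).
Definition denom f : P := \d_(repr f).

(* The extension of a derivation D to fractions, by the quotient rule for the
   chosen representative of f; [frac_deriv_div] shows that the value does not
   depend on that choice. *)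
Definition frac_deriv f : K :=
  tofrac (D (numer f) * denom f - numer f * D (denom f))
    / tofrac (denom f ^+ 2).

Lemma denom_neq0 f : denom f != 0.
Proof. exact: denom_ratioP. Qed.

Lemma tofrac_denom_neq0 f : tofrac (denom f) != 0.
Proof. by rewrite tofrac_eq0 denom_neq0. Qed.

Lemma numer_denom f : f = tofrac (numer f) / tofrac (denom f).
Proof.
apply: (mulIf (tofrac_denom_neq0 f)); rewrite mulfVK ?tofrac_denom_neq0 //.
move: (denom_neq0 f); rewrite /numer /denom.
set x := repr _ => x0; have -> : f = \pi_{fraction P} x by rewrite reprK.
unlock FracField.tofrac; rewrite -[LHS]FracField.pi_mul.
apply/eqmodP; rewrite /= FracField.equivfE /FracField.mulf /=.
by rewrite !numden_Ratio ?mulf_neq0 ?oner_eq0 // !mulr1 mulrC.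
Qed.

Hypothesis DD : forall p q, D (p + q) = D p + D q.
Hypothesis DM : forall p q, D (p * q) = D p * q + p * D q.

Lemma frac_deriv_div p q : q != 0 ->
  frac_deriv (tofrac p / tofrac q)
    = tofrac (D p * q - p * D q) / tofrac (q ^+ 2).
Proof.
move=> q0; set f := _ / _.
have e : numer f * q = p * denom f.
  have := numer_denom f; rewrite {1}/f => /eqP.
  rewrite eqr_div ?tofrac_denom_neq0 ?tofrac_eq0 // -!tofracM tofrac_eq.
  by move/eqP=> <-; rewrite mulrC.
have e' := congr1 D e; rewrite !DM in e'.
rewrite /frac_deriv; move: (denom_neq0 f) e e'.
move: (numer f) (denom f) => a b b0 e e'.
apply/eqP; rewrite eqr_div ?tofrac_eq0 ?expf_neq0 // -!tofracM tofrac_eq.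
apply/eqP.
have -> : (D a * b - a * D b) * q ^+ 2
  = b * q * (D a * q + a * D q) - (a * q) * (b * D q + D b * q) by ring.
by rewrite e' e; ring.
Qed.

Lemma frac_deriv_tofrac p : D 1 = 0 -> frac_deriv (tofrac p) = tofrac (D p).
Proof.
move=> D1; have -> : tofrac p = tofrac p / tofrac 1 by rewrite tofrac1 divr1.
rewrite frac_deriv_div ?oner_eq0 // D1 mulr0 subr0 mulr1 expr1n.
by rewrite tofrac1 divr1.
Qed.

Lemma frac_deriv_divE p q : q != 0 ->
  frac_deriv (tofrac p / tofrac q)
    = (tofrac (D p) * tofrac q - tofrac p * tofrac (D q)) / tofrac q ^+ 2.
Proof. by move=> q0; rewrite frac_deriv_div // tofracXn tofracB 2!tofracM. Qed.

Lemma frac_derivD f g : frac_deriv (f + g) = frac_deriv f + frac_deriv g.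
Proof.
rewrite [f]numer_denom [g]numer_denom.
move: (numer f) (denom f) (numer g) (denom g) (denom_neq0 f) (denom_neq0 g).
move=> a b p q b0 q0; have bq0 := mulf_neq0 b0 q0.
have [tb tq] : tofrac b != 0 /\ tofrac q != 0 by rewrite !tofrac_eq0.
have E1 : tofrac (a * q + p * b)
    = tofrac a * tofrac q + tofrac p * tofrac b by rewrite tofracD 2!tofracM.
have E2 : tofrac (b * q) = tofrac b * tofrac q by rewrite tofracM.
have E3 : tofrac (D (a * q + p * b))
    = tofrac (D a) * tofrac q + tofrac a * tofrac (D q)
      + (tofrac (D p) * tofrac b + tofrac p * tofrac (D b)).
  by rewrite DD 2!DM 3!tofracD 4!tofracM.
have E4 : tofrac (D (b * q))
    = tofrac (D b) * tofrac q + tofrac b * tofrac (D q).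
  by rewrite DM tofracD 2!tofracM.
rewrite (addf_div _ _ tb tq) -[X in X / _]E1 -[X in _ / X]E2.
rewrite (frac_deriv_divE _ b0) (frac_deriv_divE _ q0) (frac_deriv_divE _ bq0).
by rewrite E1 E2 E3 E4; apply: quotient_ruleD.
Qed.

Lemma frac_derivM f g : frac_deriv (f * g) = frac_deriv f * g + f * frac_deriv g.
Proof.
rewrite [f]numer_denom [g]numer_denom.
move: (numer f) (denom f) (numer g) (denom g) (denom_neq0 f) (denom_neq0 g).
move=> a b p q b0 q0; have bq0 := mulf_neq0 b0 q0.
have [tb tq] : tofrac b != 0 /\ tofrac q != 0 by rewrite !tofrac_eq0.
have E1 : tofrac (a * p) = tofrac a * tofrac p by rewrite tofracM.
have E2 : tofrac (b * q) = tofrac b * tofrac q by rewrite tofracM.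
have E3 : tofrac (D (a * p))
    = tofrac (D a) * tofrac p + tofrac a * tofrac (D p).
  by rewrite DM tofracD 2!tofracM.
have E4 : tofrac (D (b * q))
    = tofrac (D b) * tofrac q + tofrac b * tofrac (D q).
  by rewrite DM tofracD 2!tofracM.
rewrite mulf_div -[X in X / _]E1 -[X in _ / X]E2.
rewrite (frac_deriv_divE _ b0) (frac_deriv_divE _ q0) (frac_deriv_divE _ bq0).
by rewrite E1 E2 E3 E4; apply: quotient_ruleM.
Qed.

End FractionDerivation.

(* The complex numbers, as a + bi over a complete Archimedean ordered field. *)
Definition complexes (R : realType) : fieldType := R[i].

(* The field C(x_0, ..., x_d) of rational functions. *)
Notation ratfun C d := {fraction {mpoly C[d.+1]}}.

Section RationalFunctions.
Variables (C : fieldType) (d : nat).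
Local Notation P := {mpoly C[d.+1]}.
Local Notation K := (ratfun C d).
Local Notation tofrac := (@FracField.tofrac P).
Implicit Types (f g : K) (i : 'I_d.+1) (X Y : K -> K).

Definition ratvar i : K := tofrac 'X_i.
Definition ratconst (a : C) : K := tofrac a%:MP.

Definition pderiv i : K -> K := frac_deriv (mderiv i).

Definition is_derivation X : Prop :=
  [/\ forall f g, X (f + g) = X f + X g,
      forall f g, X (f * g) = X f * g + f * X g
    & forall a, X (ratconst a) = 0].

Definition commutator X Y : K -> K := fun f => X (Y f) - Y (X f).

Lemma pderiv_poly i p : pderiv i (tofrac p) = tofrac p^`M(i).
Proof.
apply: frac_deriv_tofrac (mderivC i 1).
exact: mderivM.
Qed.

Lemma pderiv_var i j : pderiv i (ratvar j) = (i == j)%:R.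
Proof.
rewrite pderiv_poly mderivX mnm1E eq_sym; case: eqP => [->|_].
  by rewrite scale1r -{1}[U_(j)%MM]add0m addmK mpolyX0 tofrac1.
by rewrite scale0r tofrac0.
Qed.

Lemma pderiv_derivation i : is_derivation (pderiv i).
Proof.
split=> [f g|f g|a].
- by apply: frac_derivD; [exact: mderivD | exact: mderivM].
- by apply: frac_derivM; exact: mderivM.
- by rewrite pderiv_poly mderivC tofrac0.
Qed.

Lemma sum_derivation (I : Type) (s : seq I) (Q : pred I) (h : I -> K)
    (D : I -> K -> K) :
  (forall j, is_derivation (D j)) ->
  is_derivation (fun f => \sum_(j <- s | Q j) h j * D j f).
Proof.
move=> DD; split=> [f g|f g|a].
- rewrite -big_split; apply: eq_bigr => j _.
  by case: (DD j) => -> _ _; rewrite mulrDr.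
- rewrite mulr_suml mulr_sumr -big_split; apply: eq_bigr => j _.
  by case: (DD j) => _ -> _ /=; ring.
- by rewrite big1 // => j _; case: (DD j) => _ _ ->; rewrite mulr0.
Qed.

End RationalFunctions.

(* For r >= 2 the r = r.-1.+1 variables are, in this order,
   c_1, ..., c_(r-1), Lambda_(2r-1); so c_k has index k.-1. *)
Section Fields.
Variables (C : fieldType) (r : nat).
Local Notation K := (ratfun C r.-1).
Implicit Types (V : K -> K) (f : K) (k m n : nat).

Definition cvar k : K :=
  if (1 <= k <= r.-1)%N then ratvar C (inord k.-1) else 0.
Definition Lam : K := ratvar C ord_max.

Definition dc k : K -> K := pderiv (inord k.-1).
Definition dLam : K -> K := pderiv ord_max.

(* Only used for r <= m, so that m - a below is never truncated. *)
Definition Ssym m : K :=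
  if (m <= 2 * r - 2)%N then - \sum_(1 <= a < r) cvar a * cvar (m - a)
  else if m == (2 * r - 1)%N then Lam else 0.

Definition V0 : K -> K := fun f =>
  \sum_(1 <= k < r) k%:R * cvar k * dc k f
    + (2 * r - 1)%:R * Lam * dLam f.

(* Only the values h k with 1 <= k <= r - n matter. *)
Definition has_form n V : Prop :=
  exists h : nat -> K,
    V =1 (fun f => \sum_(1 <= k < (r - n).+1) h k * dc k f).

Definition shifts_S n V : Prop :=
  forall m, (r <= m <= 2 * r - 1)%N -> V (Ssym m) = (m%:R - n%:R) * Ssym (m + n).

Definition is_Vn n V : Prop := has_form n V /\ shifts_S n V.

Lemma has_form_derivation n V : has_form n V -> is_derivation V.
Proof.
case=> h VE; have [DD DM DC] : is_derivation
    (fun f => \sum_(1 <= k < (r - n).+1) h k * dc k f).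
  by apply: sum_derivation => k; apply: pderiv_derivation.
by split=> [f g|f g|a]; rewrite !VE; [exact: DD | exact: DM | exact: DC].
Qed.

Lemma dc_cvar k l : (1 <= k < r)%N -> (1 <= l < r)%N ->
  dc k (cvar l) = (k == l)%:R.
Proof.
move=> kr lr; rewrite /dc /cvar ifT; last by lia.
rewrite pderiv_var -val_eqE /= !inordK; try lia.
by congr ((nat_of_bool _)%:R); apply/eqP/eqP; lia.
Qed.

Lemma dc_Lam k : (1 <= k < r)%N -> dc k Lam = 0.
Proof.
move=> kr; rewrite /dc pderiv_var -val_eqE /= inordK; last by lia.
by rewrite (_ : (k.-1 == r.-1) = false) //; apply/eqP; lia.
Qed.

Lemma dLam_cvar k : (1 <= k < r)%N -> dLam (cvar k) = 0.
Proof.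
move=> kr; rewrite /dLam /cvar ifT; last by lia.
rewrite pderiv_var -val_eqE /= inordK; last by lia.
by rewrite (_ : (r.-1 == k.-1) = false) //; apply/eqP; lia.
Qed.

Lemma dLam_Lam : dLam Lam = 1.
Proof. by rewrite /dLam pderiv_var eqxx. Qed.

End Fields.

(* Main.v *)
Require Import Defs.
From mathcomp Require Import all_boot all_order all_algebra.
From mathcomp Require Import boolp reals complex mpoly.
From mathcomp Require Import ring zify.

Set Implicit Arguments.
Unset Strict Implicit.
Unset Printing Implicit Defensive.

Import GRing.Theory.
Local Open Scope ring_scope.

(* For r <= m <= 2r-2, a derivation X satisfies
   X S_m = -2 sum_a c_(m-a) X c_a, so the equations prescribing X S_m form a
   triangular linear system in X c_1, ..., X c_(r-1) with diagonal c_(r-1).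
   Hence V_n exists, and a derivation of C(c, Lambda) is determined by its
   values on Lambda and the S_m.  The bracket relations therefore need only be
   checked on Lambda, which every V_n kills, and on the S_m, where they are
   those of the operators S_m |-> (m-n) S_(m+n). *)

(** * Derivations of the field of rational functions *)

Section Derivations.
Variables (C : fieldType) (d : nat).
Local Notation K := (ratfun C d).
Local Notation tofrac := (@FracField.tofrac {mpoly C[d.+1]}).
Implicit Types (f g a : K) (X Y : K -> K).

Lemma ratconst_nat n : ratconst d (n%:R : C) = n%:R.
Proof. by rewrite /ratconst mpolyC_nat rmorph_nat. Qed.

Section OneDerivation.
Variable X : K -> K.
Hypothesis derX : is_derivation X.

Lemma derivation0 : X 0 = 0.
Proof. by case: derX => DD _ _; apply: (addrI (X 0)); rewrite -DD !addr0. Qed.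

Lemma derivationN f : X (- f) = - X f.
Proof.
by case: derX => DD _ _; apply/eqP; rewrite -addr_eq0 -DD addNr derivation0.
Qed.

Lemma derivation_sum (I : Type) (s : seq I) (Q : pred I) (F : I -> K) :
  X (\sum_(i <- s | Q i) F i) = \sum_(i <- s | Q i) X (F i).
Proof. by case: derX => DD _ _; apply: (big_morph X DD derivation0). Qed.

Lemma derivation_nat n : X n%:R = 0.
Proof. by case: derX => _ _ DC; rewrite -ratconst_nat DC. Qed.

Lemma derivation_natM n f : X (n%:R * f) = n%:R * X f.
Proof. by case: derX => _ DM _; rewrite DM derivation_nat mul0r add0r. Qed.

Lemma derivation_natBM m n f :
  X ((m%:R - n%:R) * f) = (m%:R - n%:R) * X f.
Proof.
by case: derX => DD _ _; rewrite !mulrBl DD derivationN !derivation_natM.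
Qed.

Lemma derivation_eq0_poly p :
  (forall i, X (ratvar C i) = 0) -> X (tofrac p) = 0.
Proof.
case: derX => DD DM DC X0; elim/mpolyind: p => [|c m p _ _ IH].
  by rewrite tofrac0 derivation0.
rewrite tofracD DD IH addr0 -mul_mpolyC tofracM DM DC mul0r add0r.
suff -> : X (tofrac 'X_[m]) = 0 by rewrite mulr0.
rewrite mpolyXE_id rmorph_prod.
elim/big_rec: _ => [|i g _ Xg0]; first by rewrite -[1]/(1%:R) derivation_nat.
rewrite DM Xg0 mulr0 addr0 rmorphXn.
suff -> : X (tofrac 'X_i ^+ m i) = 0 by rewrite mul0r.
elim: (m i) => [|k IHk]; first by rewrite expr0 -[1]/(1%:R) derivation_nat.
by rewrite exprS DM IHk [X _]X0 mul0r mulr0 addr0.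
Qed.

(** Write [q * f = p] with polynomials [p] and [q]. Both are killed by [X], so the Leibniz rule
    leaves [q * X f = 0] with [q] nonzero. *)
Lemma derivation_eq0 : (forall i, X (ratvar C i) = 0) -> X =1 (fun=> 0).
Proof.
move=> X0 f; case: (derX) => _ DM _.
have q0 := tofrac_denom_neq0 f; have E := numer_denom f.
have /eqP := derivation_eq0_poly (numer f) X0.
rewrite (_ : tofrac (numer f) = tofrac (denom f) * f); last first.
  by rewrite {3}E mulrCA divff // mulr1.
rewrite DM (derivation_eq0_poly _ X0) mul0r add0r mulf_eq0 (negPf q0).
by move/eqP.
Qed.

End OneDerivation.

Lemma derivationD X Y :
  is_derivation X -> is_derivation Y -> is_derivation (fun f => X f + Y f).
Proof.
move=> [XD XM XC] [YD YM YC]; split=> [f g|f g|c].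
- by rewrite XD YD addrACA.
- by rewrite XM YM mulrDl mulrDr addrACA.
- by rewrite XC YC addr0.
Qed.

Lemma derivationZ a X : is_derivation X -> is_derivation (fun f => a * X f).
Proof.
move=> [XD XM XC]; split=> [f g|f g|c].
- by rewrite XD mulrDr.
- by rewrite XM mulrDr mulrA mulrCA.
- by rewrite XC mulr0.
Qed.

Lemma derivationB X Y :
  is_derivation X -> is_derivation Y -> is_derivation (fun f => X f - Y f).
Proof.
move=> dX /(derivationZ (- 1)) dY; have := derivationD dX dY.
by congr is_derivation; apply/funext => f; rewrite mulN1r.
Qed.

Lemma derivation_commutator X Y :
  is_derivation X -> is_derivation Y -> is_derivation (commutator X Y).
Proof.
move=> dX dY; case: (dX) (dY) => [XD XM XC] [YD YM YC].
split=> [f g|f g|c]; rewrite /commutator.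
- by rewrite XD YD XD YD opprD addrACA.
- rewrite XM YM XD YD !XM !YM.
  move: (X (Y f)) (X (Y g)) (Y (X f)) (Y (X g)) (X f) (X g) (Y f) (Y g).
  by move=> *; ring.
- by rewrite XC YC (derivation0 dX) (derivation0 dY) subrr.
Qed.

End Derivations.

(** * The variables, the S_m and the Euler field V_0 *)

Section Symbols.
Variables (C : fieldType) (r : nat).
Local Notation K := (ratfun C r.-1).
Local Notation c := (@cvar C r).
Local Notation S := (@Ssym C r).
Local Notation Lam := (@Lam C r).
Implicit Types (X Y V : K -> K) (k l m n : nat).

Lemma cvar_out k : (r <= k)%N -> c k = 0.
Proof. by move=> rk; rewrite /cvar ifF //; lia. Qed.

Lemma ratvar_cases (i : 'I_r.-1.+1) :
  ratvar C i = Lam \/ exists2 k, (1 <= k < r)%N & ratvar C i = c k.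
Proof.
have [/eqP|ir] := altP (i =P ord_max); first by move/eqP=> ->; left.
have lt_ir : (i < r.-1)%N.
  rewrite ltn_neqAle -ltnS ltn_ord andbT.
  by apply: contraNneq ir => e; apply/eqP/val_inj.
right; exists i.+1; first by lia.
by rewrite /cvar ifT /= ?inord_val //; lia.
Qed.

Lemma Ssym_out m : (2 * r - 1 < m)%N -> S m = 0.
Proof. by move=> mr; rewrite /Ssym !ifF //; lia. Qed.

Lemma V0_derivation : is_derivation (@V0 C r).
Proof.
apply: derivationD; last exact/derivationZ/pderiv_derivation.
apply: (@sum_derivation _ _ _ _ _ (fun k => k%:R * c k) (fun k => @dc C r k)).
by move=> k; apply: pderiv_derivation.
Qed.

Lemma V0_Lam : V0 Lam = (2 * r - 1)%:R * Lam.
Proof.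
rewrite /V0 dLam_Lam mulr1 big_nat_cond big1 ?add0r // => k /andP[kr _].
by rewrite dc_Lam ?mulr0.
Qed.

Lemma V0_cvar k : V0 (c k) = k%:R * c k.
Proof.
have [kr|kr] := boolP (1 <= k < r)%N; last first.
  rewrite (_ : c k = 0) ?mulr0 ?(derivation0 V0_derivation) //.
  by rewrite /cvar ifF //; lia.
rewrite /V0 dLam_cvar // mulr0 addr0.
rewrite (bigD1_seq k) ?mem_index_iota ?iota_uniq //= dc_cvar // eqxx mulr1.
rewrite big_seq_cond big1 ?addr0 // => j.
rewrite mem_index_iota => /andP[jr /negPf jk].
by rewrite dc_cvar // jk mulr0.
Qed.

(** Give c_k weight k and Lambda weight 2r-1: then [V0] is the Euler field, and S_m is homogeneous
    of weight m. *)
Lemma V0_Ssym m : (r <= m)%N -> V0 (S m) = m%:R * S m.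
Proof.
have dV := V0_derivation; have [_ VM _] := dV.
move=> rm; rewrite /Ssym; case: ifP => mr.
  rewrite derivationN // derivation_sum // mulrN mulr_sumr; congr (- _).
  apply: eq_big_nat => a ar; rewrite VM !V0_cvar.
  rewrite mulrCA -mulrA -mulrDl -natrD; congr (_%:R * _); lia.
case: ifP => [/eqP ->|_]; first exact: V0_Lam.
by rewrite (derivation0 dV) mulr0.
Qed.

(** * The triangular linear system *)

Hypothesis r_ge2 : (2 <= r)%N.

(** The Leibniz rule gives two sums, exchanged by the reflection a -> m - a; hence the factor 2. *)
Lemma derivation_SsymE X m : is_derivation X -> (r <= m <= 2 * r - 2)%N ->
  X (S m) = - 2%:R * \sum_(1 <= a < r) X (c a) * c (m - a).
Proof.
move=> dX mr; have [_ XM _] := dX.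
rewrite /Ssym ifT; last by lia.
rewrite derivationN // derivation_sum // mulNr; congr (- _).
rewrite (eq_bigr (fun a => X (c a) * c (m - a) + c a * X (c (m - a)))) //.
rewrite big_split /= mulr_natl mulr2n; congr (_ + _).
(* Terms with a <= m - r vanish because c_(m-a) has index at least r. The remaining range m - r < a
   < r is stable under a -> m - a. *)
have cut (F : nat -> nat -> K) :
    (forall a, (r <= m - a)%N -> F a (m - a)%N = 0) ->
    \sum_(1 <= a < r) F a (m - a)%N
    = \sum_((m - r).+1 <= a < r) F a (m - a)%N.
  move=> F0; rewrite (big_cat_nat _ (n := (m - r).+1)) /=; try lia.
  rewrite big_nat_cond big1 ?add0r // => a /andP[ar _].
  by apply: F0; lia.
rewrite (cut (fun a b => c a * X (c b))); last first.
  by move=> a ra; rewrite (cvar_out ra) (derivation0 dX) mulr0.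
rewrite (cut (fun a b => X (c a) * c b)); last first.
  by move=> a ra; rewrite (cvar_out ra) mulr0.
rewrite big_nat_rev /=; apply: eq_big_nat => a ar; rewrite mulrC.
by congr (X (c _) * c _); lia.
Qed.

Lemma cvar_last_neq0 : c r.-1 != 0.
Proof.
rewrite /cvar ifT; last by lia.
by rewrite /ratvar tofrac_eq0 -msize_poly_eq0 msizeX.
Qed.

(** Above the diagonal the index of c is at least r, so the entry is zero; on the diagonal it is
    c_(r-1), which is nonzero. The determinant is therefore nonzero. *)
Lemma triangular_solve (N : nat) (b : nat -> K) : (N < r)%N ->
  exists h : nat -> K, forall k, (1 <= k <= N)%N ->
    \sum_(1 <= j < N.+1) h j * c (k + r.-1 - j) = b k.
Proof.
move=> Nr; pose M : 'M[K]_N := \matrix_(j, i) c (i + r.-1 - j).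
have unitM : M \in unitmx.
  rewrite unitmxE unitfE det_trig; last first.
    by apply/is_trig_mxP => i j ij; rewrite mxE cvar_out //; lia.
  apply/prodf_neq0 => i _.
  by rewrite mxE addKn cvar_last_neq0.
pose v : 'rV[K]_N := (\row_(i < N) b i.+1) *m invmx M.
(* Unknowns are numbered from 1 and matrix rows from 0; the value 0 outside the range is
   arbitrary. *)
exists (fun j => if insub j.-1 is Some i then v 0 i else 0) => k kr.
have ltkN : (k.-1 < N)%N by lia.
have := congr1 (fun w : 'rV[K]_N => w 0 (Ordinal ltkN))
  (mulmxKV unitM (\row_(i < N) b i.+1)).
rewrite -/v !mxE /= (_ : k.-1.+1 = k); last by lia.
move=> <-; rewrite big_add1 /= big_mkord; apply: eq_bigr => j _.
by rewrite [M _ _]mxE /= valK; congr (v 0 _ * c _); lia.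
Qed.

(** * Action of V_n on Lambda and on all the S_m *)

Lemma SsymLam : S (2 * r - 1) = Lam.
Proof. by rewrite /Ssym ifF ?eqxx //; lia. Qed.

Lemma has_form_Lam n V : (1 <= n)%N -> has_form n V -> V Lam = 0.
Proof.
move=> n1 [h ->]; rewrite big_nat_cond big1 // => k /andP[kr _].
by rewrite dc_Lam ?mulr0 //; lia.
Qed.

(** Beyond 2r-1 both sides vanish. This extension allows a second field to be applied to S_(l+n),
    whose index may exceed 2r-1. *)
Lemma shifts_S_ge n V m : is_Vn n V -> (r <= m)%N ->
  V (S m) = (m%:R - n%:R) * S (m + n).
Proof.
move=> [fV sV] rm; have [mr|mr] := boolP (m <= 2 * r - 1)%N.
  by apply: sV; rewrite rm.
rewrite !Ssym_out ?mulr0; try lia.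
by apply: derivation0; apply: has_form_derivation fV.
Qed.

(** This makes the convention V_N = 0 for N >= r an instance of [is_Vn], so that one bracket
    computation covers both cases. *)
Lemma is_Vn0 n : (r <= n)%N -> is_Vn n (fun=> 0 : K).
Proof.
move=> rn; split=> [|m mr]; last by rewrite Ssym_out ?mulr0 //; lia.
by exists (fun=> 0) => f; rewrite big1 // => k _; rewrite mul0r.
Qed.

(** This is the identity (l-n)(l+n-m) - (l-m)(l+m-n) = (n-m)(l-m-n) among the coefficients of
    S_(l+m+n). *)
Lemma commutator_Vn_Ssym m n V W l : is_Vn m V -> is_Vn n W -> (r <= l)%N ->
  commutator V W (S l)
  = (n%:R - m%:R) * ((l%:R - (m + n)%:R) * S (l + (m + n))).
Proof.
move=> VV VW rl.
have [dV dW] := (has_form_derivation VV.1, has_form_derivation VW.1).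
rewrite /commutator (shifts_S_ge VV) // (shifts_S_ge VW) //.
rewrite (derivation_natBM dV) (derivation_natBM dW).
rewrite (shifts_S_ge VV) ?(shifts_S_ge VW); try lia.
rewrite -!addnA [(n + m)%N]addnC !natrD.
by move: (S _) (l%:R) (m%:R) (n%:R) => *; ring.
Qed.

(** * Existence and uniqueness of V_n *)

Hypothesis two_neq0 : 2%:R != 0 :> C.

Lemma ratfun_two_neq0 : 2%:R != 0 :> K.
Proof.
by rewrite -ratconst_nat /ratconst tofrac_eq0 mpolyC_eq0.
Qed.

(* Downward induction on k: the equation for S_(k+r-1) involves only
   X c_k, ..., X c_(r-1). *)
Lemma derivation_Ssym_eq0 X : is_derivation X -> X Lam = 0 ->
  (forall m, (r <= m <= 2 * r - 1)%N -> X (S m) = 0) -> X =1 (fun=> 0).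
Proof.
move=> dX XL XS.
have Xc j k : (r - j <= k < r)%N -> (1 <= k)%N -> X (c k) = 0.
  elim: j k => [|j IH] k kr k1; first by lia.
  have [kj|kj] := boolP (r - j <= k)%N; first by apply: IH; lia.
  have /eqP : X (S (k + r.-1)%N) = 0 by apply: XS; lia.
  rewrite derivation_SsymE //; last by lia.
  rewrite mulNr oppr_eq0 mulf_eq0 (negPf ratfun_two_neq0) /=.
  (* With m = k + r - 1, terms a < k vanish because c_(m-a) does, and terms a > k by induction; X
     c_k times c_(r-1) is left. *)
  rewrite (big_cat_nat _ (n := k)) /=; try lia.
  rewrite big_nat_cond big1 => [|a /andP[ak _]]; last first.
    by rewrite [c (_ - _)]cvar_out ?mulr0 //; lia.
  rewrite add0r big_ltn; last by lia.
  rewrite [X in _ + X]big_nat_cond [X in _ + X]big1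
    => [|a /andP[ak _]]; last first.
    by rewrite IH ?mul0r //; lia.
  rewrite addr0 mulf_eq0 addKn (negPf cvar_last_neq0) orbF.
  by move/eqP.
apply: derivation_eq0 => // i; case: (ratvar_cases i) => [->//|[k kr ->]].
by apply: (Xc r); lia.
Qed.

Lemma derivation_Ssym_inj X Y : is_derivation X -> is_derivation Y ->
  X Lam = Y Lam -> (forall m, (r <= m <= 2 * r - 1)%N -> X (S m) = Y (S m)) ->
  X =1 Y.
Proof.
move=> dX dY XYL XYS f; apply/eqP; rewrite -subr_eq0; apply/eqP.
apply: (derivation_Ssym_eq0 (derivationB dX dY)) => [|m mr].
  by rewrite XYL subrr.
by rewrite XYS // subrr.
Qed.

(** The r-n unknown coefficients are fixed by the equations for r <= m <= 2r-1-n; for larger m both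
    sides vanish. *)
Lemma is_Vn_exists n : (1 <= n <= r - 1)%N -> exists V : K -> K, is_Vn n V.
Proof.
move=> nr.
(* The divisor is the factor -2 of [derivation_SsymE]. Equation k of the system is the one for m = k
   + r - 1. *)
pose rhs m := (m%:R - n%:R) * S (m + n) / - 2%:R.
have [|h hP] := @triangular_solve (r - n) (fun k => rhs (k + r.-1)%N).
  by lia.
pose V f := \sum_(1 <= k < (r - n).+1) h k * @dc C r k f.
have formV : has_form n V by exists h.
have dV := has_form_derivation formV.
have Vc a : (1 <= a < r)%N -> V (c a) = if (a <= r - n)%N then h a else 0.
  move=> ar; rewrite /V.
  case: ifP => an.
    rewrite (bigD1_seq a) ?mem_index_iota ?iota_uniq //=; last by lia.
    rewrite dc_cvar // eqxx mulr1 big_seq_cond big1 ?addr0 // => k.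
    rewrite mem_index_iota => /andP[kr /negPf ka].
    by rewrite dc_cvar ?ka ?mulr0 //; lia.
  rewrite big_nat_cond big1 // => k /andP[kr _].
  by rewrite dc_cvar 1?(_ : (k == a) = false) ?mulr0 //; lia.
exists V; split=> // m mr.
have [mE|mE] := eqVneq m (2 * r - 1)%N.
  by rewrite mE SsymLam (has_form_Lam _ formV) ?Ssym_out ?mulr0 //; lia.
rewrite derivation_SsymE //; last by lia.
have -> : \sum_(1 <= a < r) V (c a) * c (m - a)
        = \sum_(1 <= a < (r - n).+1) h a * c (m - a).
  rewrite (big_cat_nat _ (n := (r - n).+1)) /=; try lia.
  rewrite [X in _ + X]big_nat_cond [X in _ + X]big1
    => [|a /andP[ar _]]; last first.
    by rewrite Vc ?ifF ?mul0r //; lia.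
  by rewrite addr0; apply: eq_big_nat => a ar; rewrite Vc ?ifT //; lia.
(* If m + n >= 2r, then a <= r - n gives m - a >= r, so every c_(m-a) in the sum is zero, as is
   S_(m+n). *)
have [mn|mn] := boolP (m + n <= 2 * r - 1)%N; last first.
  rewrite Ssym_out ?mulr0; last by lia.
  rewrite big_nat_cond big1 ?mulr0 // => a /andP[ar _].
  by rewrite [c (_ - _)]cvar_out ?mulr0 //; lia.
have mk : ((m - r.-1) + r.-1 = m)%N by lia.
have := hP (m - r.-1)%N; rewrite mk => ->; last by lia.
by rewrite /rhs mulrC divfK // oppr_eq0 ratfun_two_neq0.
Qed.

Lemma is_Vn_unique n V W : (1 <= n)%N -> is_Vn n V -> is_Vn n W -> V =1 W.
Proof.
move=> n1 [fV sV] [fW sW].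
apply: (derivation_Ssym_inj (has_form_derivation fV) (has_form_derivation fW)).
  by rewrite (has_form_Lam n1 fV) (has_form_Lam n1 fW).
by move=> m mr; rewrite sV // sW.
Qed.

(** * Bracket relations *)

Lemma commutator_V0 n V : (1 <= n)%N -> is_Vn n V ->
  commutator (@V0 C r) V =1 (fun f => n%:R * V f).
Proof.
move=> n1 VV; have [fV sV] := VV; have dV := has_form_derivation fV.
have d0 := V0_derivation.
apply: (derivation_Ssym_inj (derivation_commutator d0 dV) (derivationZ _ dV)).
  rewrite /commutator V0_Lam derivation_natM // (has_form_Lam n1 fV) mulr0.
  by rewrite (derivation0 d0) mulr0 subrr.
(* The coefficients of S_(m+n) in the two compositions are (m-n)(m+n) and m(m-n), with difference
   n(m-n). *)
move=> m mr; rewrite /commutator V0_Ssym; last by lia.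
rewrite derivation_natM // sV // derivation_natBM // V0_Ssym; last by lia.
by rewrite natrD; move: (S _) (m%:R) (n%:R) => *; ring.
Qed.

(** Both sides kill Lambda and agree on the S_l. Leaving [U] arbitrary admits the zero field when m
    + n >= r. *)
Lemma commutator_Vn m n V W U : (1 <= m)%N -> (1 <= n)%N ->
  is_Vn m V -> is_Vn n W -> is_Vn (m + n) U ->
  commutator V W =1 (fun f => (n%:R - m%:R) * U f).
Proof.
move=> m1 n1 VV VW VU.
have [dV dW] := (has_form_derivation VV.1, has_form_derivation VW.1).
have dU := has_form_derivation VU.1.
apply: (derivation_Ssym_inj (derivation_commutator dV dW) (derivationZ _ dU)).
  rewrite /commutator (has_form_Lam m1 VV.1) (has_form_Lam n1 VW.1).
  by rewrite (has_form_Lam _ VU.1) ?addn_gt0 ?m1 // (derivation0 dV)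
    (derivation0 dW) subrr mulr0.
move=> l lr; rewrite (commutator_Vn_Ssym VV VW) ?(shifts_S_ge VU) //; lia.
Qed.

End Symbols.

Theorem theorem4p1 (R : realType) (r : nat) (r_ge2 : (2 <= r)%N) :
  (forall n : nat, (1 <= n <= r - 1)%N ->
     exists! V : ratfun (complexes R) r.-1 -> ratfun (complexes R) r.-1, is_Vn n V)
  /\
  (forall V : nat -> ratfun (complexes R) r.-1 -> ratfun (complexes R) r.-1,
     (forall n : nat, (1 <= n <= r - 1)%N -> is_Vn n (V n)) ->
     [/\ forall n : nat, (1 <= n <= r - 1)%N ->
           commutator (@V0 (complexes R) r) (V n) =1 (fun f => n%:R * V n f),
         forall m n : nat, (1 <= m <= r - 1)%N -> (1 <= n <= r - 1)%N ->
           commutator (V m) (V n) =1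
             (fun f => if (m + n <= r - 1)%N
                       then (n%:R - m%:R) * V (m + n)%N f else 0)
       & let Vext (N : nat) := if (N < r)%N then V N else (fun=> 0) in
         forall m n : nat, (1 <= m <= r - 1)%N -> (1 <= n <= r - 1)%N ->
           commutator (Vext m) (Vext n) =1
             (fun f => (n%:R - m%:R) * Vext (m + n)%N f)]).
Proof.
have two0 : 2%:R != 0 :> complexes R by rewrite (@Num.Theory.pnatr_eq0 R[i]).
split=> [n nr|V VP].
  have [V VV] := is_Vn_exists r_ge2 two0 nr.
  exists V; split=> // W VW; apply/funext.
  by apply: (is_Vn_unique r_ge2 two0 _ VV VW); lia.
have VV m n : (1 <= m <= r - 1)%N -> (1 <= n <= r - 1)%N ->
    commutator (V m) (V n) =1
      (fun f => if (m + n <= r - 1)%N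
                then (n%:R - m%:R) * V (m + n)%N f else 0).
  move=> mr nr f; case: ifP => mnr.
    by apply: (commutator_Vn r_ge2 two0) => //;
      [lia|lia|exact: VP|exact: VP|apply: VP; lia].
  have rmn : (r <= m + n)%N by lia.
  (* Here the zero field serves as V_(m+n). *)
  have VZ := is_Vn0 (complexes R) r_ge2 rmn.
  rewrite (commutator_Vn r_ge2 two0 _ _ (VP m mr) (VP n nr) VZ) ?mulr0 //; lia.
split=> // [n nr|Vext m n mr nr f].
  by apply: (commutator_V0 r_ge2 two0 _ (VP n nr)); lia.
have [ltmr ltnr] : (m < r)%N /\ (n < r)%N by lia.
rewrite /Vext ltmr ltnr VV // (_ : (m + n < r)%N = (m + n <= r - 1)%N); last by lia.
by case: ifP; rewrite ?mulr0.
Qed.
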